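(* There exist upper triangular matrices $A^{(1)},A^{(2)}\in\mathcal{M}_{S_1}(2,1)$ such that for every $k\ge 0$ the $k$-th diagonals $A^{(1)}_k$ and $A^{(2)}_k$ coincide up to a permutation of their entries, and such that $$A^{(2)}\in\mathcal{B}(D,\ell_2)^K\qquad\text{and}\qquad A^{(1)}\notin\mathcal{B}(D,\ell_2)^K .$$ Consequently, for every permutation-invariant functional $\Phi$ on diagonals and every set $S$ of sequences, $$\bigl\{A \text{ upper triangular}:\ (\Phi(A_k))_{k\ge0}\in S\bigr\}\ \neq\ \mathcal{B}(D,\ell_2)^K ;$$ in particular $\mathcal{M}_{\infty}(2,1)\not\subset\mathcal{B}(D,\ell_2)^K$ and $\mathcal{M}_{S_1}(2,1)\not\subset\mathcal{B}(D,\ell_2)^K$.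
   Context: All matrices are infinite complex matrices $A=(a_{j,m})_{j,m\ge1}$, upper triangular: $a_{j,m}=0$ for $m<j$. For $k\ge0$ the $k$-th diagonal $A_k$ is the matrix agreeing with $A$ on the entries $(l,l+k)$, $l\ge1$, and vanishing elsewhere; write $a_k^{\,l}:=a_{l,l+k}$. Put $\|A_k\|_{B(\ell_2)}=\sup_l|a_k^{\,l}|$ and $\|A_k\|_{S_1}=\sum_l|a_k^{\,l}|$ (values in $[0,\infty]$). Dyadic blocks: $I_0=\{0,1\}$ and $I_n=\{k:2^n\le k<2^{n+1}\}$ for $n\ge1$. For a sequence $x=(x_k)_{k\ge0}$, $\|x\|_{\ell(2,1)}=\sum_{n\ge0}\bigl(\sum_{k\in I_n}|x_k|^2\bigr)^{1/2}$. The space $\mathcal{M}_{S_1}(2,1)$ (resp. $\mathcal{M}_\infty(2,1)$) consists of the upper triangular $A$ with $\|(\|A_k\|_{S_1})_{k\ge0}\|_{\ell(2,1)}<\infty$ (resp. $\|(\|A_k\|_{B(\ell_2)})_{k\ge0}\|_{\ell(2,1)}<\infty$). Matricial Bloch space: for $0\le r<1$ let $A'(r)=\sum_{k\ge1}kA_kr^{k-1}$ (entrywise), required to define a bounded operator on $\ell_2$ for each $r$. $\mathcal{B}(D,\ell_2)$ is the space of upper triangular $A$ with $\|A\|_{\mathcal{B}(D,\ell_2)}:=\sup_{0\le r<1}(1-r^2)\|A'(r)\|_{B(\ell_2)}+\|A_0\|_{B(\ell_2)}<\infty$. Köthe dual: $\mathcal{B}(D,\ell_2)^K$ is the set of upper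 triangular $A$ such that $\sum_{j,m}|a_{j,m}b_{j,m}|<\infty$ for every $B=(b_{j,m})\in\mathcal{B}(D,\ell_2)$. A functional $\Phi$ on diagonals (with values in $[0,\infty]$) assigns a value to each diagonal, regarded as its sequence of entries $(a_k^{\,l})_{l\ge1}$; it is called permutation-invariant if it depends only on the multiset of the moduli of the entries. $S$ is an arbitrary set of sequences $(s_k)_{k\ge0}$ with values in $[0,\infty]$. *)

(* Defs.v *)
From HB Require Import structures.
From mathcomp Require Import all_boot all_order all_algebra.
From mathcomp Require Import all_classical all_reals all_analysis.
From mathcomp.real_closed Require Import complex.

Set Implicit Arguments.
Unset Strict Implicit.
Unset Printing Implicit Defensive.

Import Order.TTheory GRing.Theory Num.Theory.
Import numFieldNormedType.Exports.
Import Normc.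

Local Open Scope classical_set_scope.
Local Open Scope card_scope.
Local Open Scope ring_scope.
Local Open Scope complex_scope.
Local Open Scope ereal_scope.

(* Rows, columns and diagonal entries are numbered from 0 instead of 1; the
   diagonal index k = (column - row) is unaffected by this shift. *)
Definition infmx (R : realType) := nat -> nat -> R[i].

Definition upper (R : realType) (A : infmx R) : Prop :=
  forall j m : nat, (m < j)%N -> A j m = 0%R.

(* The k-th diagonal as a sequence of entries, and as a matrix. *)
Definition diag (R : realType) (A : infmx R) (k : nat) : nat -> R[i] :=
  fun l => A l (l + k)%N.

Definition diagmx (R : realType) (A : infmx R) (k : nat) : infmx R :=
  fun j m => if m == (j + k)%N then A j m else 0%R.

Definition norm_sup (R : realType) (a : nat -> R[i]) : \bar R :=
  ereal_sup [set (normc (a l))%:E | l in [set: nat]].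

Definition norm_S1 (R : realType) (a : nat -> R[i]) : \bar R :=
  \sum_(0 <= l <oo) (normc (a l))%:E.

(* The block is I_n = [block_start n, 2^(n+1)), with I_0 = {0, 1}. *)
Definition block_start (n : nat) : nat := if n is 0%N then 0%N else (2 ^ n)%N.

Definition norm_l21 (R : realType) (x : nat -> \bar R) : \bar R :=
  \sum_(0 <= n <oo)
    sqrte (\sum_(block_start n <= k < 2 ^ n.+1) `|x k| ^+ 2).

Definition M_S1_21 (R : realType) : set (infmx R) :=
  [set A | upper A /\ norm_l21 (fun k => norm_S1 (diag A k)) < +oo].

Definition M_infty_21 (R : realType) : set (infmx R) :=
  [set A | upper A /\ norm_l21 (fun k => norm_sup (diag A k)) < +oo].

Definition norm_l2 (R : realType) (x : nat -> R[i]) : \bar R :=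
  sqrte (\sum_(0 <= m <oo) ((normc (x m)) ^+ 2)%:E).

(* Partial sums of the j-th coordinate of A x; the regular module R[i]^o
   carries the topology of the complex plane. *)
Definition mxapp_psum (R : realType) (A : infmx R) (x : nat -> R[i])
    (j : nat) : nat -> R[i]^o :=
  series (fun m => (A j m * x m)%R : R[i]^o).

Definition mxapp (R : realType) (A : infmx R) (x : nat -> R[i]) : nat -> R[i] :=
  fun j => limn (mxapp_psum A x j).

(* Meaningful when the series defining A x converge for all x in l_2, which
   is part of bounded_op. *)
Definition op_norm (R : realType) (A : infmx R) : \bar R :=
  ereal_sup [set norm_l2 (mxapp A x) | x in [set x | norm_l2 x <= 1]].

Definition bounded_op (R : realType) (A : infmx R) : Prop :=
  (forall x : nat -> R[i], norm_l2 x < +oo ->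
     forall j : nat, cvgn (mxapp_psum A x j)) /\
  op_norm A < +oo.

(* The entrywise sum over all k >= 1 is finite: the (j, m) entry of the k-th
   diagonal matrix vanishes for k > m. *)
Definition mxderiv (R : realType) (A : infmx R) (r : R) : infmx R :=
  fun j m => (\sum_(1 <= k < m.+1) k%:R * diagmx A k j m * (r%:C) ^+ k.-1)%R.

Definition bloch_norm (R : realType) (A : infmx R) : \bar R :=
  ereal_sup [set (1 - r ^+ 2)%:E * op_norm (mxderiv A r)
            | r in [set r : R | (0 <= r < 1)%R]]
  + norm_sup (diag A 0%N).

Definition bloch (R : realType) : set (infmx R) :=
  [set A | [/\ upper A,
               forall r : R, (0 <= r < 1)%R -> bounded_op (mxderiv A r)
             & bloch_norm A < +oo]].

Definition kothe_dual (R : realType) (X : set (infmx R)) : set (infmx R) :=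
  [set A | upper A /\
     forall B : infmx R, X B ->
       \esum_(p in [set: nat * nat])
          (normc (A p.1 p.2 * B p.1 p.2)%R)%:E < +oo].

(* Every value t >= 0 occurs with the same (possibly infinite) multiplicity
   among the moduli of a and of b. *)
Definition same_moduli (R : realType) (a b : nat -> R[i]) : Prop :=
  forall t : R, [set l : nat | normc (a l) = t] #= [set l : nat | normc (b l) = t].

Definition perm_invariant (R : realType) (Phi : (nat -> R[i]) -> \bar R) : Prop :=
  forall a b : nat -> R[i], same_moduli a b -> Phi a = Phi b.

Definition equal_up_to_perm (T : Type) (a b : nat -> T) : Prop :=
  exists2 s : nat -> nat, bijective s & forall l : nat, a l = b (s l).

(* Main.v *)
Require Import Defs.
From HB Require Import structures.
From mathcomp Require Import all_boot all_order all_algebra.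
From mathcomp Require Import all_classical all_reals all_analysis.
From mathcomp.real_closed Require Import complex.
From mathcomp Require Import ring lra zify.

(* Both matrices have the single entry 1/(k+1) on the k-th diagonal, so every
   diagonal norm equals 1/(k+1), and this sequence lies in l(2,1).
   - In A2 the entries form the first row. The l_2 norm of the first row of
     B'(r) is at most |B'(r)|; at r = 1 - 1/2^(n+2) this bounds
     sum_{2^n <= k < 2^(n+1)} |b_{0,k}|^2 uniformly in n for a Bloch matrix B,
     and Cauchy-Schwarz on dyadic blocks makes A2 pair absolutely with B.
   - In A1 the entries sit at the positions (j, 2j), in distinct rows and
     columns. A matrix supported there has operator norm the supremum of its
     entries, so the indicator of these positions is a Bloch matrix, since
     j r^(j-1) (1 - r) <= 1; its pairing with A1 is the harmonic series. *)

Set Implicit Arguments.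
Unset Strict Implicit.
Unset Printing Implicit Defensive.

Import Order.TTheory GRing.Theory Num.Theory.
Import numFieldNormedType.Exports.

Local Open Scope classical_set_scope.
Local Open Scope ring_scope.
Local Open Scope complex_scope.
Local Open Scope ereal_scope.

Section DiagonalsAndKothe.
Variable R : realType.
Implicit Types (A B : infmx R) (x : nat -> R[i]).

(** * Complex moduli and series of nonnegative terms *)

Lemma normc_real (r : R) : Normc.normc r%:C = `|r|%R.
Proof. by rewrite /= expr0n /= addr0 sqrtr_sqr. Qed.

Lemma normc_ge0 (z : R[i]) : (0 <= Normc.normc z)%R.
Proof. by case: z => a b; exact: sqrtr_ge0. Qed.

Lemma mulc_conj (z : R[i]) : (z * z^*%C = ((Normc.normc z) ^+ 2)%:C)%R.
Proof. by rewrite -sqr_normc -rmorphXn. Qed.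

Lemma normc_conj (z : R[i]) : Normc.normc z^*%C = Normc.normc z.
Proof. by case: z => a b /=; rewrite sqrrN. Qed.

Lemma nneseries_le (u : nat -> \bar R) (c : \bar R) :
  (forall n, 0 <= u n) -> (forall n, \sum_(0 <= i < n) u i <= c) ->
  \sum_(0 <= i <oo) u i <= c.
Proof.
move=> u0 uc; apply: lime_le; first exact: is_cvg_nneseries.
exact: nearW.
Qed.

Lemma nneseries1 (u : nat -> \bar R) (i : nat) :
  (forall n, 0 <= u n) -> (forall n, n != i -> u n = 0) ->
  \sum_(0 <= n <oo) u n = u i.
Proof.
move=> u0 ui; rewrite (nneseriesD1 (n := i))// eseries0 ?adde0// => k _.
exact: ui.
Qed.

(** * Rows of a matrix and its operator norm *)

Lemma cvg_mxapp_psum A x (j N : nat) :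
  (forall m, (N <= m)%N -> (A j m * x m = 0)%R) ->
  mxapp_psum A x j @ \oo --> (\sum_(0 <= m < N) (A j m * x m)%R : R[i]^o)%R.
Proof.
move=> Ax0; apply: cvg_near_cst; exists N => // n /= Nn.
rewrite /mxapp_psum /series /= (big_cat_nat _ Nn)//=.
rewrite [X in (_ + X)%R]big_nat [X in (_ + X)%R]big1 ?addr0// => m.
by move=> /andP[Nm _]; exact: Ax0.
Qed.

Lemma mxapp_finite A x (j N : nat) :
  (forall m, (N <= m)%N -> (A j m * x m = 0)%R) ->
  mxapp A x j = (\sum_(0 <= m < N) A j m * x m)%R.
Proof. by move/cvg_mxapp_psum => /cvg_lim; apply; exact: norm_hausdorff. Qed.

(** Test vector: the conjugate of row [j], cut off at [N] and normalized. Its support is finite, and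
    the [j]-th coordinate of its image is the l_2 norm of the truncated row. *)
Lemma row_le_op_norm A (j N : nat) :
  (Num.sqrt (\sum_(0 <= m < N) Normc.normc (A j m) ^+ 2))%:E <= op_norm A.
Proof.
set s := (\sum_(0 <= m < N) _)%R.
have s0 : (0 <= s)%R by apply: sumr_ge0 => m _; exact: exprn_ge0 (normc_ge0 _).
(* If [s = 0], the convention [0^-1 = 0] makes [x] the zero vector. *)
pose x m := if (m < N)%N then ((A j m)^*%C * ((Num.sqrt s)^-1)%:C)%R else 0%R.
have xN m : (N <= m)%N -> x m = 0%R by rewrite leqNgt /x => /negbTE ->.
have nx m : (m < N)%N ->
    (Normc.normc (x m) ^+ 2 = Normc.normc (A j m) ^+ 2 / s)%R.
  move=> mN; rewrite /x mN Normc.normcM normc_real normc_conj exprMn.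
  by rewrite ger0_norm ?invr_ge0 ?sqrtr_ge0// exprVn sqr_sqrtr.
have mxE : mxapp A x j = (Num.sqrt s)%:C.
  rewrite (@mxapp_finite _ _ _ N); last by move=> m /xN ->; rewrite mulr0.
  rewrite big_nat (eq_bigr (fun m => (Normc.normc (A j m) ^+ 2)%:C *
    ((Num.sqrt s)^-1)%:C))%R; last first.
    by move=> m /andP[_ mN]; rewrite /x mN mulrA mulc_conj.
  rewrite -big_nat -mulr_suml -rmorph_sum -rmorphM -/s; congr (_%:C).
  have [->|sn0] := eqVneq s 0%R; first by rewrite mul0r sqrtr0.
  have sq0 : Num.sqrt s != 0%R by rewrite gt_eqF// sqrtr_gt0 lt0r sn0.
  by rewrite -{1}(sqr_sqrtr s0) expr2 mulfK.
apply: (@le_trans _ _ (norm_l2 (mxapp A x))).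
  pose u m := ((Normc.normc (mxapp A x m)) ^+ 2)%:E.
  rewrite /norm_l2 -/u.
  rewrite -[X in (Num.sqrt X)%:E](sqr_sqrtr s0) -[leLHS]/(sqrte _%:E).
  have u0 n : 0 <= u n by rewrite lee_fin exprn_ge0// normc_ge0.
  rewrite lee_sqrt; last by apply: nneseries_ge0 => n _ _; exact: u0.
  rewrite [leLHS](_ : _ = u j); last first.
    by rewrite /u mxE normc_real ger0_norm ?sqrtr_ge0.
  rewrite (nneseriesD1 (n := j))//; last by move=> k _; exact: u0.
  by apply: leeDl; apply: nneseries_ge0 => n _ _; exact: u0.
apply: ereal_sup_ubound; exists x => //=.
rewrite /norm_l2 -[leRHS]/(1%:E) -sqrtr1 -[leRHS]/(sqrte _%:E) lee_sqrt//.
apply: nneseries_le => [n|n]; first by rewrite lee_fin exprn_ge0// normc_ge0.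
apply: (@le_trans _ _ (\sum_(0 <= i < N) (Normc.normc (x i) ^+ 2)%:E)).
  have [nN|/ltnW Nn] := leqP n N.
    rewrite (big_cat_nat _ nN)//= leeDl// sume_ge0// => i _.
    by rewrite lee_fin exprn_ge0// normc_ge0.
  rewrite (big_cat_nat _ Nn)//= [X in _ + X]big_nat [X in _ + X]big1 ?adde0//.
  by move=> i /andP[/xN -> _]; rewrite Normc.normc0 expr0n.
rewrite sumEFin lee_fin big_nat (eq_bigr (fun m =>
  Normc.normc (A j m) ^+ 2 / s))%R => [|m /andP[_]]; last exact: nx.
rewrite -big_nat -mulr_suml -/s.
by have [->|sn0] := eqVneq s 0%R; rewrite ?mul0r// divff.
Qed.

(** * Entries of the derivative and estimates for powers *)

Lemma mxderiv_upper A (r : R) (j m : nat) : (j <= m)%N ->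
  mxderiv A r j m = ((m - j)%:R * A j m * r%:C ^+ (m - j).-1)%R.
Proof.
move=> jm; rewrite /mxderiv /diagmx.
(* On the main diagonal no [k >= 1] matches, and the right side vanishes by its factor
   [m - j = 0]. *)
have [d0|d0] := posnP (m - j)%N.
  rewrite d0 !mul0r big_nat big1// => k /andP[k1 _].
  by rewrite ifF ?mulr0 ?mul0r//; lia.
rewrite (bigD1_seq (m - j)%N) ?iota_uniq ?mem_index_iota//=; last lia.
rewrite subnKC// eqxx big1_seq ?addr0// => k /andP[km _].
by rewrite ifF ?mulr0 ?mul0r//; lia.
Qed.

Lemma mxderiv_lower A (r : R) (j m : nat) : upper A -> (m < j)%N ->
  mxderiv A r j m = 0%R.
Proof.
move=> uA mj; rewrite /mxderiv /diagmx big1// => k _.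
by rewrite uA// if_same mulr0 mul0r.
Qed.

(** Each [r ^ i] with [i < n] is at least [r ^ n.-1], and multiplying their sum by [1 - r]
    telescopes to [1 - r ^ n]. *)
Lemma geometric_weight_le (r : R) (n : nat) : (0 <= r < 1)%R ->
  (n%:R * r ^+ n.-1 * (1 - r) <= 1)%R.
Proof.
move=> /andP[r0 r1].
have H : (n%:R * r ^+ n.-1 <= \sum_(i < n) r ^+ i)%R.
  rewrite mulr_natl -[X in (_ *+ X)%R](card_ord n) -sumr_const.
  apply: ler_sum => i _; apply: ler_wiXn2l => //; first exact: ltW.
  by case: i => i /= ; lia.
apply: (@le_trans _ _ ((\sum_(i < n) r ^+ i) * (1 - r))%R).
  by rewrite ler_wpM2r// subr_ge0 ltW.
by rewrite mulrC -opprB mulNr -subrX1 opprB gerBl exprn_ge0.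
Qed.

Lemma Bernoulli_le (t : R) (n : nat) : (0 <= t <= 1)%R ->
  (1 - n%:R * t <= (1 - t) ^+ n)%R.
Proof.
move=> /andP[t0 t1]; elim: n => [|n IH]; first by rewrite mul0r subr0.
rewrite exprS; apply: (@le_trans _ _ ((1 - t) * (1 - n%:R * t))%R).
  rewrite -subr_ge0 (_ : _ - _ = n%:R * t ^+ 2)%R; last by rewrite -natr1; ring.
  by rewrite mulr_ge0// sqr_ge0.
by rewrite ler_wpM2l// subr_ge0.
Qed.

(** * Growth of the first row of a Bloch matrix *)

Lemma op_norm_ge0 A : 0 <= op_norm A.
Proof. by have := row_le_op_norm A 0 0; rewrite big_geq// sqrtr0. Qed.

Lemma bloch_bounded B : bloch B ->
  exists2 C : R, (0 <= C)%R & forall r : R, (0 <= r < 1)%R ->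
    (1 - r ^+ 2)%:E * op_norm (mxderiv B r) <= C%:E.
Proof.
case=> _ _; rewrite /bloch_norm; set E := ereal_sup _ => bB.
have Eub (r : R) : (0 <= r < 1)%R ->
    (1 - r ^+ 2)%:E * op_norm (mxderiv B r) <= E.
  by move=> r01; apply: ereal_sup_ubound; exists r.
(* Both summands of the Bloch norm are nonnegative, so finiteness of the sum makes [E] a real
   number. *)
have E0 : 0 <= E.
  apply: le_trans (Eub 0%R _); last by rewrite lexx ltr01.
  by rewrite expr0n subr0 mul1e op_norm_ge0.
have nB0 : 0 <= norm_sup (diag B 0).
  apply: (@le_trans _ _ (Normc.normc (diag B 0 0))%:E).
    by rewrite lee_fin normc_ge0.
  by apply: ereal_sup_ubound; exists 0%N.
have Efin : E \is a fin_num.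
  by rewrite ge0_fin_numE//; apply: le_lt_trans bB; rewrite leeDl.
by exists (fine E); [rewrite fine_ge0|move=> r r01; rewrite fineK// Eub].
Qed.

Lemma bloch_first_row B : bloch B ->
  exists2 C : R, (0 <= C)%R & forall n,
    (\sum_(2 ^ n <= m < 2 ^ n.+1) Normc.normc (B 0%N m) ^+ 2 <= C)%R.
Proof.
move=> /[dup] -[uB _ _] /bloch_bounded[C C0 CB].
exists (64 * C ^+ 2)%R => [|n]; first by rewrite mulr_ge0// sqr_ge0.
(* With [t = 1 / (4 M)] every [m < 2 M] has [m * t < 1/2], so Bernoulli keeps [r ^ m.-1] above 1/2
   on the block. *)
pose M : R := (2 ^ n)%:R; pose t : R := ((4 * M)^-1)%R; pose r : R := (1 - t)%R.
have M1 : (1 <= M)%R by rewrite ler1n expn_gt0.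
have M0 : (0 < M)%R by exact: lt_le_trans M1.
have tM : (t * M = 4^-1)%R by rewrite /t; field; rewrite gt_eqF.
have t0 : (0 < t)%R by rewrite invr_gt0 mulr_gt0.
have t1 : (t <= 4^-1)%R by rewrite -tM ler_peMr// ltW.
have r01 : (0 <= r < 1)%R by rewrite /r; apply/andP; split; lra.
set s := (\sum_(0 <= m < 2 ^ n.+1)
  Normc.normc (mxderiv B r 0%N m) ^+ 2)%R.
have s0 : (0 <= s)%R by apply: sumr_ge0 => m _; rewrite exprn_ge0// normc_ge0.
have ts : (t * Num.sqrt s <= C)%R.
  rewrite -lee_fin; apply: le_trans (CB r r01).
  rewrite EFinM lee_pmul ?lee_fin ?sqrtr_ge0 ?(ltW t0)//; last first.
    exact: row_le_op_norm.
  (* Here [1 - r ^+ 2 = t (2 - t)], and [t <= 1]. *)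
  rewrite /r; nra.
have {}ts : (t ^+ 2 * s <= C ^+ 2)%R.
  rewrite -(sqr_sqrtr s0) -exprMn ler_pXn2r// nnegrE.
  by rewrite mulr_ge0 ?sqrtr_ge0// ltW.
have bs : ((M / 2) ^+ 2 * \sum_(2 ^ n <= m < 2 ^ n.+1)
    Normc.normc (B 0%N m) ^+ 2 <= s)%R.
  rewrite /s (@big_cat_nat _ _ _ (2 ^ n)%N 0)//=; last by rewrite leq_exp2l.
  rewrite mulr_sumr ler_wpDl ?sumr_ge0// => [m _|].
    by rewrite exprn_ge0// normc_ge0.
  apply: ler_sum_nat => m /andP[nm mn].
  have mM : (m%:R < 2 * M)%R by rewrite -natrM -expnS ltr_nat.
  have Mb0 : (0 <= M / 2 * Normc.normc (B 0%N m))%R.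
    by rewrite mulr_ge0 ?normc_ge0// divr_ge0// ltW.
  rewrite -exprMn ler_pXn2r ?nnegrE ?normc_ge0//.
  rewrite mxderiv_upper// subn0 !Normc.normcM.
  rewrite -[(m%:R)%R](rmorph_nat (real_complex R)) -rmorphXn !normc_real.
  rewrite normr_nat ger0_norm ?exprn_ge0//; last by case/andP: r01.
  have rm : (2^-1 <= r ^+ m.-1)%R.
    apply: le_trans (@Bernoulli_le t m.-1 _); last first.
      by apply/andP; split; lra.
    have : ((m.-1)%:R * t <= 2 * M * t)%R.
      rewrite ler_pM2r//; apply: le_trans (ltW mM).
      by rewrite ler_nat leq_pred.
    lra.
  have Mm : (M <= m%:R)%R by rewrite ler_nat.
  by rewrite [leRHS]mulrAC ler_wpM2r ?normc_ge0// ler_pM// ltW.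
have : (t ^+ 2 * ((M / 2) ^+ 2 * \sum_(2 ^ n <= m < 2 ^ n.+1)
    Normc.normc (B 0%N m) ^+ 2) <= C ^+ 2)%R.
  by apply: le_trans ts; rewrite ler_wpM2l// sqr_ge0.
(* Since [t * (M / 2) = 1/8], the constant is 64. *)
rewrite mulrA -exprMn mulrA tM => h.
by have {h} := h; set S := (\sum_(_ <= _ < _) _)%R => h; lra.
Qed.

(** The complement of [range e] contributes nothing, and [e] reindexes the rest. This turns each
    pairing over pairs of indices into an ordinary series along the support. *)
Lemma esum_support (T : choiceType) (e : nat -> T) (a : T -> \bar R) :
  injective e -> (forall p, 0 <= a p) -> (forall p, ~ range e p -> a p = 0) ->
  \esum_(p in [set: T]) a p = \sum_(0 <= k <oo) a (e k).
Proof.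
move=> ei a0 ae; rewrite nneseries_esumT//.
rewrite -(@esum_image _ _ _ setT e a); last by move=> ? ? _ _; exact: ei.
rewrite (esumID (range e)) ?setTI; last by [].
by rewrite [X in _ + X]esum1 ?adde0// => p; rewrite setTI => -[?]; exact: ae.
Qed.

(** * The two matrices, and the pairing of the first row with Bloch matrices *)

Definition first_row_harmonic : infmx R :=
  fun j m => if j == 0%N then (harmonic m)%:C else 0%R.

(** Position [(j, 2j)] lies on diagonal [j]. General weights cover the harmonic matrix, the
    indicator and its derivatives at once. *)
Definition doubling_mx (w : nat -> R) : infmx R :=
  fun j m => if m == j.*2 then (w j)%:C else 0%R.

(** With [q = 2^(-1/2)], block bounds of order 2^(-n/2) become terms of a convergent geometric
    series. *)
Lemma sqrt_half_dyadic : exists2 q : R, (0 < q < 1)%R &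
  forall n, ((q ^+ n) ^+ 2 = (2 ^ n)%:R^-1)%R.
Proof.
have q2 : ((Num.sqrt 2^-1) ^+ 2 = 2^-1 :> R)%R by rewrite sqr_sqrtr.
have q0 : (0 < Num.sqrt 2^-1 :> R)%R by rewrite sqrtr_gt0.
exists (Num.sqrt 2^-1)%R => [|n]; first by rewrite q0/=; nra.
by rewrite exprAC q2 natrX exprVn.
Qed.

Lemma harmonic_dyadic_le (n k : nat) : (2 ^ n <= k.+1)%N ->
  (@harmonic R k <= (2 ^ n)%:R^-1)%R.
Proof.
by move=> nk; rewrite /harmonic lef_pV2 ?posrE ?ltr0n ?expn_gt0// ler_nat.
Qed.

Lemma kothe_first_row_harmonic : kothe_dual (@bloch R) first_row_harmonic.
Proof.
split=> [j m mj|B /bloch_first_row[C C0 CB]].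
  by rewrite /first_row_harmonic; case: eqP mj => // ->.
rewrite (esum_support (e := fun k => (0%N, k))); first last.
- case=> [[|j] m] /= Np; first by exfalso; apply: Np; exists m.
  by rewrite mul0r Normc.normc0.
- by move=> p; rewrite lee_fin normc_ge0.
- by move=> k l [].
pose y k : R := (harmonic k * Normc.normc (B 0%N k))%R.
have y0 k : (0 <= y k)%R by rewrite mulr_ge0 ?normc_ge0 ?harmonic_ge0.
have [q /andP[q0 q1] q2n] := sqrt_half_dyadic.
(* AM-GM replaces Cauchy-Schwarz: with [p = 2^(-n/2)], the squares contribute at most [p * C / 2]
   and the 2^n constants [p ^+ 3 / 2] add up to [p / 2]. *)
have block n :
    (\sum_(2 ^ n <= k < 2 ^ n.+1) y k <= geometric ((C + 1) / 2) q n)%R.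
  rewrite /geometric /=; set p := (q ^+ n)%R.
  have p0 : (0 < p)%R by exact: exprn_gt0.
  have p2 : (p ^+ 2 * (2 ^ n)%:R = 1)%R.
    by rewrite q2n mulVf// pnatr_eq0 -lt0n expn_gt0.
  (* AM-GM: [b p^2 <= (p b^2 + p^3) / 2] *)
  apply: (@le_trans _ _ (\sum_(2 ^ n <= k < 2 ^ n.+1)
     (p / 2 * (Normc.normc (B 0%N k)) ^+ 2 + p ^+ 3 / 2))%R).
    apply: ler_sum_nat => k /andP[nk _].
    apply: (@le_trans _ _ (p ^+ 2 * Normc.normc (B 0%N k))%R).
      by rewrite ler_wpM2r ?normc_ge0// q2n harmonic_dyadic_le// ltnW.
    set b := Normc.normc _.
    rewrite -subr_ge0.
    rewrite (_ : _ - _ = p / 2 * (b - p) ^+ 2)%R; last by field.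
    by rewrite mulr_ge0 ?sqr_ge0// divr_ge0// ltW.
  rewrite big_split/= -mulr_sumr sumr_const_nat.
  rewrite (_ : (2 ^ n.+1 - 2 ^ n = 2 ^ n)%N); last by rewrite expnS; lia.
  have -> : (p ^+ 3 / 2 *+ 2 ^ n = p / 2)%R.
    rewrite -mulr_natr -[RHS]mul1r -[X in (X * (p / 2))%R]p2; ring.
  have := CB n; set S := (\sum_(_ <= _ < _) _)%R; nra.
(* The blocks start at 1, so column 0 is the separate term [y 0]. *)
have dyadic n : (\sum_(0 <= k < 2 ^ n) y k <= y 0%N + (C + 1) / 2 / (1 - q))%R.
  apply: (@le_trans _ _ (y 0%N + series (geometric ((C + 1) / 2) q) n)%R).
    elim: n => [|n IH]; first by rewrite big_nat1 /series /= big_geq// addr0.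
    rewrite (@big_cat_nat _ _ _ (2 ^ n)%N 0)//=; last by rewrite leq_exp2l.
    by rewrite /series/= big_nat_recr//= addrA lerD// block.
  rewrite lerD2l geometric_le_lim//; last by rewrite gtr0_norm.
  by rewrite divr_ge0// addr_ge0.
apply: (@le_lt_trans _ _ (y 0%N + (C + 1) / 2 / (1 - q))%:E); last exact: ltry.
apply: nneseries_le => [n|n]; first by rewrite lee_fin normc_ge0.
rewrite sumEFin lee_fin; apply: le_trans (dyadic n).
rewrite (@big_cat_nat _ _ _ n 0 (2 ^ n)%N)//=; last exact/ltnW/ltn_expl.
rewrite ler_wpDr ?sumr_ge0//; apply: ler_sum => k _.
rewrite /first_row_harmonic/= Normc.normcM normc_real.
by rewrite ger0_norm ?harmonic_ge0.
Qed.

(** * Doubling matrices: operator norm, Bloch norm and divergent pairing *)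

Lemma upper_doubling (w : nat -> R) : upper (doubling_mx w).
Proof. by move=> j m mj; rewrite /doubling_mx ifF//; lia. Qed.

Lemma mxderiv_doubling (w : nat -> R) (r : R) :
  mxderiv (doubling_mx w) r = doubling_mx (fun j => j%:R * w j * r ^+ j.-1)%R.
Proof.
apply/funext => j; apply/funext => m.
have [mj|jm] := ltnP m j.
  by rewrite mxderiv_lower ?upper_doubling//; exact: upper_doubling.
rewrite mxderiv_upper// /doubling_mx; case: eqP => [->|_].
  by rewrite -addnn addnK !rmorphM rmorph_nat rmorphXn.
by rewrite mulr0 mul0r.
Qed.

Lemma doubling_mx_row_eq0 (w : nat -> R) x (j m : nat) : (j.*2.+1 <= m)%N ->
  (doubling_mx w j m * x m = 0)%R.
Proof. by move=> jm; rewrite /doubling_mx ifF ?mul0r//; lia. Qed.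

(** Coordinate [j] of the image is [w j * x (2j)], and distinct [j] read distinct coordinates of
    [x], so the squares sum to at most [c ^+ 2] times those of [x]. *)
Lemma op_norm_doubling_le (w : nat -> R) (c : R) : (forall j, `|w j| <= c)%R ->
  op_norm (doubling_mx w) <= c%:E.
Proof.
move=> wc; have c0 : (0 <= c)%R by exact: le_trans (wc 0%N).
apply: ge_ereal_sup => _ [x /= x1 <-].
have nE j : Normc.normc (mxapp (doubling_mx w) x j) =
    (`|w j| * Normc.normc (x j.*2))%R.
  rewrite (@mxapp_finite _ _ _ j.*2.+1); last exact: doubling_mx_row_eq0.
  rewrite big_nat_recr//= big_nat big1 => [|m /andP[_ mj]]; last first.
    by rewrite /doubling_mx ifF ?mul0r//; lia.
  by rewrite add0r /doubling_mx eqxx Normc.normcM normc_real.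
have x0 n : 0 <= ((Normc.normc (x n)) ^+ 2)%:E.
  by rewrite lee_fin exprn_ge0// normc_ge0.
pose X := \sum_(0 <= m <oo) ((Normc.normc (x m)) ^+ 2)%:E.
have cX : (c ^+ 2)%:E * X <= (c ^+ 2)%:E.
  rewrite -[leRHS]mule1 lee_wpmul2l ?lee_fin ?sqr_ge0//.
  rewrite -[leLHS]sqr_sqrte ?nneseries_ge0//.
  by rewrite -(mule1 1) expe2 lee_pmul ?sqrte_ge0.
apply: (@le_trans _ _ (sqrte (c ^+ 2)%:E)); last first.
  by rewrite /= sqrtr_sqr ger0_norm.
rewrite lee_sqrt ?lee_fin ?sqr_ge0//; apply: le_trans cX.
rewrite -nneseriesZl//.
apply: nneseries_le => n; first by rewrite lee_fin sqr_ge0.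
apply: (@le_trans _ _ (\sum_(0 <= m < n.*2)
    ((c ^+ 2)%:E * ((Normc.normc (x m)) ^+ 2)%:E))); last first.
  by apply: nneseries_lim_ge => m _ _; rewrite mule_ge0 ?lee_fin ?sqr_ge0.
elim: n => [|n IH]; first by rewrite !big_geq.
(* One more coordinate of the image is paid for by [x (2n)]; the term of [x (2n+1)] is dropped. *)
rewrite doubleS !big_nat_recr//= -addeA leeD//.
rewrite nE exprMn EFinM -[leLHS]adde0 leeD ?mule_ge0 ?lee_fin ?sqr_ge0//.
by rewrite ler_wpM2r ?sqr_ge0// ler_pXn2r ?nnegrE.
Qed.

Lemma bloch_doubling1 : bloch (doubling_mx (fun=> 1%R)).
Proof.
have wb (r : R) : (0 <= r < 1)%R ->
    op_norm (mxderiv (doubling_mx (fun=> 1%R)) r) <= ((1 - r)^-1)%:E.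
  move=> r01; rewrite mxderiv_doubling; apply: op_norm_doubling_le => j.
  case/andP: (r01) => r0 r1.
  rewrite mulr1 ger0_norm ?mulr_ge0 ?exprn_ge0//.
  by rewrite -[leRHS]mul1r ler_pdivlMr ?subr_gt0// geometric_weight_le.
split=> [|r r01|].
- exact: upper_doubling.
- split; last exact: le_lt_trans (wb r r01) (ltry _).
  move=> x _ j; rewrite mxderiv_doubling; apply/cvg_ex; eexists.
  exact/cvg_mxapp_psum/doubling_mx_row_eq0.
(* The derivative part is at most [(1 - r ^+ 2) / (1 - r) = 1 + r <= 2]; the main diagonal adds at
   most 1. *)
- apply: (@le_lt_trans _ _ (2%:E + 1%:E)); last exact: ltry.
  apply: leeD.
    apply: ge_ereal_sup => _ [r /= r01 <-]; case/andP: (r01) => r0 r1.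
    apply: (@le_trans _ _ ((1 - r ^+ 2)%:E * ((1 - r)^-1)%:E)).
      by rewrite lee_wpmul2l ?wb// lee_fin; nra.
    rewrite -EFinM lee_fin ler_pdivrMr ?subr_gt0//; nra.
  apply: ge_ereal_sup => _ [l _ <-]; rewrite lee_fin /diag /doubling_mx.
  by case: ifP => _; [rewrite normc_real normr1 | rewrite Normc.normc0].
Qed.

Lemma not_kothe_doubling_harmonic :
  ~ kothe_dual (@bloch R) (doubling_mx harmonic).
Proof.
case=> _ /(_ _ bloch_doubling1).
rewrite (esum_support (e := fun k => (k, k.*2))); first last.
- move=> [j m] /= Np; rewrite {1}/doubling_mx; case: eqP => [mj|_].
    by exfalso; apply: Np; exists j => //; rewrite mj.
  by rewrite mul0r Normc.normc0.
- by move=> p; rewrite lee_fin normc_ge0.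
- by move=> k l [].
rewrite (@eq_eseriesr _ _ (EFin \o @harmonic R)); last first.
  move=> k _ /=; rewrite /doubling_mx !eqxx -rmorphM mulr1 normc_real.
  by rewrite ger0_norm ?harmonic_ge0.
(* A finite pairing would bound the increasing harmonic partial sums and make them converge. *)
move=> hoo; apply: (@dvg_harmonic R).
apply: nondecreasing_is_cvgn.
  apply/nondecreasing_seqP => n; rewrite /series/= big_nat_recr//= lerDl.
  exact: harmonic_ge0.
have h0 n : 0 <= (EFin \o @harmonic R) n by rewrite lee_fin harmonic_ge0.
exists (fine (\sum_(0 <= k <oo) (EFin \o harmonic) k)) => _ [n _ <-].
rewrite -lee_fin fineK ?ge0_fin_numE ?nneseries_ge0//.
rewrite /series/= -sumEFin; exact: nneseries_lim_ge.
Qed.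

(** * Diagonal norms and the mixed norm of the harmonic sequence *)

Lemma norm_S1_single (a : nat -> R[i]) (i : nat) :
  (forall l, l != i -> a l = 0%R) -> norm_S1 a = (Normc.normc (a i))%:E.
Proof.
move=> ai; rewrite /norm_S1 (nneseries1 (i := i))// => l.
  by rewrite lee_fin normc_ge0.
by move=> /ai ->; rewrite Normc.normc0.
Qed.

Lemma norm_sup_single (a : nat -> R[i]) (i : nat) :
  (forall l, l != i -> a l = 0%R) -> norm_sup a = (Normc.normc (a i))%:E.
Proof.
move=> ai; apply/eqP; rewrite eq_le; apply/andP; split.
  apply: ge_ereal_sup => _ [l _ <-]; rewrite lee_fin.
  by have [->//|/ai ->] := eqVneq l i; rewrite Normc.normc0 normc_ge0.
by apply: ereal_sup_ubound; exists i.
Qed.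

(** Block [n] has at most 2^(n+1) terms, each at most 2^(-n). Its l_2 norm is thus at most
    [sqrt 2 * q ^+ n], which is summable. *)
Lemma norm_l21_harmonic : norm_l21 (fun k => (@harmonic R k)%:E) < +oo.
Proof.
have [q /andP[q0 q1] q2n] := sqrt_half_dyadic.
apply: (@le_lt_trans _ _ ((Num.sqrt 2) / (1 - q))%:E); last exact: ltry.
apply: nneseries_le => [n|n]; first exact: sqrte_ge0.
apply: (@le_trans _ _ (series (geometric (Num.sqrt 2) q) n)%:E); last first.
  by rewrite lee_fin geometric_le_lim// gtr0_norm.
rewrite seriesEnat -sumEFin; apply: lee_sum => {}n _.
have p0 : (0 < q ^+ n)%R by exact: exprn_gt0.
have -> : geometric (Num.sqrt 2) q n = Num.sqrt (2 * (q ^+ n) ^+ 2).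
  by rewrite sqrtrM// sqrtr_sqr gtr0_norm.
rewrite -[leRHS]/(sqrte _%:E) lee_sqrt ?lee_fin ?mulr_ge0 ?(ltW p0)//.
under eq_bigr do rewrite abse_EFin ger0_norm ?harmonic_ge0// -EFin_expe.
rewrite sumEFin lee_fin.
apply: (@le_trans _ _ (\sum_(block_start n <= k < 2 ^ n.+1) (q ^+ n) ^+ 4)%R).
  apply: ler_sum_nat => k /andP[nk _].
  rewrite (exprM _ 2 2) ler_pXn2r ?nnegrE ?harmonic_ge0 ?sqr_ge0// q2n.
  (* Block 0 starts at [k = 0], where [2 ^ 0 <= k.+1] still holds. *)
  by apply: harmonic_dyadic_le; case: n {p0} nk => //= n; exact: leqW.
rewrite sumr_const_nat (exprM _ 2 2).
apply: (@le_trans _ _ (((q ^+ n) ^+ 2) ^+ 2 *+ (2 ^ n.+1))%R).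
  by rewrite ler_wpMn2l ?sqr_ge0// leq_subr.
rewrite q2n -mulr_natr expnS natrM.
have M0 : ((2 ^ n)%:R != 0 :> R)%R by rewrite pnatr_eq0 -lt0n expn_gt0.
rewrite (_ : _ * _ = 2 / (2 ^ n)%:R)%R//; by field.
Qed.

(** * Diagonals up to permutation *)

Lemma diag_doubling (w : nat -> R) (k : nat) :
  diag (doubling_mx w) k = fun l => if l == k then (w k)%:C else 0%R.
Proof.
apply/funext => l; rewrite /diag /doubling_mx -addnn eqn_add2l eq_sym.
by case: eqP => [->|].
Qed.

(** The permutation carries each level set of the moduli of [a] bijectively onto that of [b]. *)
Lemma same_moduli_perm (a b : nat -> R[i]) :
  equal_up_to_perm a b -> same_moduli a b.
Proof.
move=> [s [s' sK s'K] ab] t; rewrite card_eq_sym.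
have -> : [set l | Normc.normc (b l) = t] =
    [set s l | l in [set l | Normc.normc (a l) = t]].
  apply/seteqP; split=> [l /= bl|_ [l /= al <-]]; last by rewrite -ab.
  by exists (s' l); rewrite /= ?ab s'K.
by apply: inj_card_eq => ? ? _ _; exact: (can_inj sK).
Qed.

Lemma diag_first_row (k : nat) :
  diag first_row_harmonic k =
  fun l => if l == 0%N then (harmonic k)%:C else 0%R.
Proof. by apply/funext => -[|l]. Qed.

Lemma diag_harmonic_perm (k : nat) :
  equal_up_to_perm (diag (doubling_mx harmonic) k) (diag first_row_harmonic k).
Proof.
(* The transposition of 0 and [k], which is the identity for [k = 0]. *)
pose s (l : nat) := if l == 0%N then k else if l == k then 0%N else l.
have sK : involutive s.
  move=> l; rewrite /s; have [->|l0] := eqVneq l 0%N.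
    by rewrite eqxx; case: eqP.
  have [->|lk] := eqVneq l k; first by rewrite eqxx.
  by rewrite (negbTE l0) (negbTE lk).
exists s; first by exists s.
move=> l; rewrite diag_doubling diag_first_row -[0%N in RHS](_ : s k = 0%N).
  by rewrite (inj_eq (inv_inj sK)).
by rewrite /s eqxx; case: eqP.
Qed.

(** A condition on the values [Phi (diag A k)] cannot separate [A1] from [A2], whereas the Köthe
    dual does. *)
Lemma kothe_dual_not_diagonal_condition
    (Phi : (nat -> R[i]) -> \bar R) (S : set (nat -> \bar R)) A1 A2 :
  perm_invariant Phi -> upper A1 ->
  (forall k, equal_up_to_perm (diag A1 k) (diag A2 k)) ->
  kothe_dual (@bloch R) A2 -> ~ kothe_dual (@bloch R) A1 ->
  [set A | upper A /\ S (fun k => Phi (diag A k))] <> kothe_dual (@bloch R).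
Proof.
move=> PhiP uA1 A12 A2K A1K E; apply: A1K.
move: A2K; rewrite -E => -[_ SA2]; split=> //.
rewrite (_ : (fun k => _) = fun k => Phi (diag A2 k))//.
by apply/funext => k; exact/PhiP/same_moduli_perm.
Qed.

End DiagonalsAndKothe.

(** * Failure of every permutation-invariant description of the dual *)

Unset Implicit Arguments.

Theorem theoremA (R : realType) :
  (exists A1 A2 : infmx R,
      [/\ M_S1_21 A1, M_S1_21 A2,
          forall k : nat, equal_up_to_perm (diag A1 k) (diag A2 k),
          kothe_dual (@bloch R) A2
        & ~ kothe_dual (@bloch R) A1]) /\
  (forall (Phi : (nat -> R[i]) -> \bar R) (S : set (nat -> \bar R)),
      (forall a : nat -> R[i], 0 <= Phi a) ->
      perm_invariant Phi ->
      (forall s : nat -> \bar R, S s -> forall k : nat, 0 <= s k) ->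
      [set A : infmx R | upper A /\ S (fun k => Phi (diag A k))]
        <> kothe_dual (@bloch R)) /\
  ~ (@M_infty_21 R `<=` kothe_dual (@bloch R)) /\
  ~ (@M_S1_21 R `<=` kothe_dual (@bloch R)).
Proof.
have uA1 := upper_doubling (@harmonic R).
have A2K := @kothe_first_row_harmonic R.
have A1K := @not_kothe_doubling_harmonic R.
have hN k : Normc.normc (@harmonic R k)%:C = harmonic k.
  by rewrite normc_real ger0_norm ?harmonic_ge0.
have A1k k l : l != k -> diag (doubling_mx (@harmonic R)) k l = 0%R.
  by rewrite diag_doubling => /negbTE ->.
have A1S1 : M_S1_21 (doubling_mx (@harmonic R)).
  split=> //; rewrite (_ : (fun k => _) = fun k => (harmonic k)%:E).
    exact: norm_l21_harmonic.
  by apply/funext => k; rewrite (norm_S1_single (A1k k)) diag_doubling eqxx hN.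
(* Each diagonal has a single nonzero entry, so its supremum and its sum coincide. *)
have A1sup : M_infty_21 (doubling_mx (@harmonic R)).
  split=> //; rewrite (_ : (fun k => _) = fun k => (harmonic k)%:E).
    exact: norm_l21_harmonic.
  by apply/funext => k; rewrite (norm_sup_single (A1k k)) diag_doubling eqxx hN.
have A2S1 : M_S1_21 (@first_row_harmonic R).
  split; first by case: A2K.
  rewrite (_ : (fun k => _) = fun k => (harmonic k)%:E).
    exact: norm_l21_harmonic.
  apply/funext => k; rewrite (@norm_S1_single _ _ 0%N) diag_first_row ?hN//.
  by move=> l /negbTE ->.
have A12 := @diag_harmonic_perm R.
split; first by exists (doubling_mx harmonic), (@first_row_harmonic R).
split.
  move=> Phi S _ PhiP _.
  exact: kothe_dual_not_diagonal_condition PhiP uA1 A12 A2K A1K.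
by split=> /(_ (doubling_mx harmonic)) h; apply/A1K/h.
Qed.
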